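(* Let $\langle\mathbf{A},m\rangle$ be a monotone semilattice. (1) If $\mathcal{F}\subseteq C_{\mathcal{K}_\mathbf{A}}(X(\mathbf{A}))$ is a monotone lower-Vietoris-type family of the dual $mS$-space $\langle X(\mathbf{A}),\mathcal{K}_\mathbf{A},R_m\rangle$, then $\theta_\mathcal{F}=\{(a,b)\in A^2\colon[\beta(a)^c]^-_\mathcal{F}=[\beta(b)^c]^-_\mathcal{F}\}$ is a congruence on $\langle\mathbf{A},m\rangle$ such that $\mathcal{F}=\mathcal{F}_{R_{q_{\theta_\mathcal{F}}}}$. (2) If $\theta$ is a congruence on $\langle\mathbf{A},m\rangle$, then $\theta=\theta_{\mathcal{F}_{R_{q_\theta}}}$.
   Context: A monotone semilattice is a meet-semilattice with top $\mathbf{A}$ with an order-preserving $m\colon A\to A$; congruences must also be compatible with $m$. A proper filter is irreducible if not the intersection of two filters both different from it; $X(\mathbf{B})$ is the set of irreducible filters of $\mathbf{B}$; $\beta(a)=\{P\in X(\mathbf{A})\colon a\in P\}$; $\mathcal{K}_\mathbf{A}=\{\beta(a)^c\colon a\in A\}$ (a subbase); $C_{\mathcal{K}_\mathbf{A}}(X(\mathbf{A}))$ is the set of intersections of families of sets $\beta(a)$. $\mathcal{Z}(X(\mathbf{A}))$ is the set of $Z=\bigcap\mathcal{L}$ with $\mathcal{L}\subseteq\mathcal{K}_\mathbf{A}$ dually directed; $I_\mathbf{A}(Z)=\{a\colon\beta(a)\cap Z=\emptyset\}$; $R_m\subseteq X(\mathbf{A})\times\mathcal{Z}(X(\mathbf{A}))$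 is $(P,Z)\in R_m$ iff $m^{-1}[P]\cap I_\mathbf{A}(Z)=\emptyset$. An $S$-space is a pair $\langle X,\mathcal{K}\rangle$, $\mathcal{K}$ a subbase, such that with $S(X)=\{U^c\colon U\in\mathcal{K}\}$, $C_\mathcal{K}(X)$ its intersections: (S1) $T_0$, $X=\bigcup\mathcal{K}$; (S2) $\mathcal{K}$ consists of compact opens, closed under finite unions, $\emptyset\in\mathcal{K}$; (S3) for $U,V\in\mathcal{K}$, $x\in U\cap V$, there are $W,D\in\mathcal{K}$, $x\notin W$, $x\in D$, $D\subseteq(U\cap V)\cup W$; (S4) if $Y\in C_\mathcal{K}(X)$ and $\mathcal{J}\subseteq S(X)$ is a $Y$-family (for $A,B\in\mathcal{J}$ there are $H\in S(X)$, $C\in\mathcal{J}$ with $Y\subseteq H$, $A\cap H\subseteq C$, $B\cap H\subseteq C$) with $Y\cap A^c\ne\emptyset$ for all $A\in\mathcal{J}$, then $Y\cap\bigcap\{A^c\colon A\in\mathcal{J}\}\ne\emptyset$. For a family $\mathcal{F}$ and a set $U$, $U^-_\mathcal{F}=\{Y\in\mathcal{F}\colon Y\cap U\neq\emptyset\}$, $\mathcal{M}_\mathcal{F}=\{U^-_\mathcal{F}\colon U\in\mathcal{K}_\mathbf{A}\}$. For $H\subseteq\mathcal{Z}(X(\mathbf{A}))$, $[H\cap\mathcal{K}_\mathbf{A})_\mathcal{F}=\{V\in\mathcal{K}_\mathbf{A}\colon\exists U\in H\cap\mathcal{K}_\mathbf{A}\,[U^-_\mathcal{F}\subseteq V^-_\mathcal{F}]\}$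 and $H$ is $\mathcal{M}_\mathcal{F}$-increasing if this equals $H\cap\mathcal{K}_\mathbf{A}$. A monotone lower-Vietoris-type family of $\langle X(\mathbf{A}),\mathcal{K}_\mathbf{A},R_m\rangle$ is a family $\mathcal{F}$ of nonempty members of $C_{\mathcal{K}_\mathbf{A}}(X(\mathbf{A}))$ such that $\langle\mathcal{F},\mathcal{M}_\mathcal{F}\rangle$ is an $S$-space and for each $Y\in\mathcal{F}$, $R_m[Y]=\{Z\colon\exists y\in Y\,(y,Z)\in R_m\}$ is $\mathcal{M}_\mathcal{F}$-increasing. For a congruence $\theta$, $q_\theta\colon A\to A/\theta$ is the natural map, $R_{q_\theta}\subseteq X(\mathbf{A}/\theta)\times X(\mathbf{A})$ is $(Q,P)\in R_{q_\theta}$ iff $q_\theta^{-1}[Q]\subseteq P$, and $\mathcal{F}_{R_{q_\theta}}=\{R_{q_\theta}(Q)\colon Q\in X(\mathbf{A}/\theta)\}$. *)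

(* Defs.v *)
From HB Require Import structures.
From mathcomp Require Import all_boot all_order.
From mathcomp Require Import boolp classical_sets topology.

Set Implicit Arguments.
Unset Strict Implicit.
Unset Printing Implicit Defensive.

Import Order.TTheory.
Local Open Scope classical_set_scope.

Section Filters.
Variables (d : Order.disp_t) (B : tMeetSemilatticeType d).

Definition sl_filter : set (set B) := [set G : set B |
  [/\ G (\top)%O,
      forall a b, (a <= b)%O -> G a -> G b
    & forall a b, G a -> G b -> G (a `&` b)%O]].

Definition irreducible_filter : set (set B) := [set P : set B |
  [/\ sl_filter P, P <> setT
    & ~ exists G1 G2, [/\ sl_filter G1, sl_filter G2,
                          G1 <> P, G2 <> P & P = G1 `&` G2]]].

Definition irrFilter : choiceType := set_type irreducible_filter.

Definition beta (a : B) : set irrFilter := [set P | val P a].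

Definition KA : set (set irrFilter) := [set ~` beta a | a in setT].

End Filters.

Definition subbase_space (X : choiceType) (K : set (set X)) : Type := X.

Section SSpaces.
Variables (X : choiceType) (K : set (set X)).

HB.instance Definition _ := Choice.on (subbase_space K).
HB.instance Definition _ :=
  @isSubBaseTopological.Build (subbase_space K) (set X) K id.

Definition coK : set (set X) := [set ~` U | U in K].

Definition closedK : set (set X) :=
  [set Y | exists2 J, J `<=` coK & Y = \bigcap_(V in J) V].

Definition Yfamily (Y : set X) (J : set (set X)) := forall V W, J V -> J W ->
  exists H C, [/\ coK H, J C, Y `<=` H, V `&` H `<=` C & W `&` H `<=` C].

(* In the last clause J must be nonempty: set0 always lies in closedK (it is
   the intersection of all of coK, since K covers X), so the clause with J empty
   and Y = set0 would hold in no space; with J empty and Y nonempty it is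
   trivial. *)
Record S_space : Prop := {
  S1_T0 : kolmogorov_space (subbase_space K) ;
  S1_cover : [set: X] = \bigcup_(U in K) U ;
  S2_compact_open : forall U, K U ->
    @open (subbase_space K) U /\ @compact (subbase_space K) U ;
  S2_setU : forall U V, K U -> K V -> K (U `|` V) ;
  S2_set0 : K set0 ;
  S3 : forall U V x, K U -> K V -> (U `&` V) x ->
    exists W D, [/\ K W, K D, ~ W x, D x & D `<=` (U `&` V) `|` W] ;
  S4 : forall Y J, closedK Y -> J `<=` coK -> J !=set0 -> Yfamily Y J ->
    (forall V, J V -> (Y `&` ~` V) !=set0) ->
    (Y `&` \bigcap_(V in J) ~` V) !=set0
}.

Definition dually_directed (L : set (set X)) := L !=set0 /\
  forall U V, L U -> L V -> exists2 W, L W & W `<=` U `&` V.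

Definition ZK : set (set X) := [set Z | exists L,
  [/\ L `<=` K, dually_directed L & Z = \bigcap_(U in L) U]].

End SSpaces.

Section Hit.
Variables (X : Type) (F : set (set X)).

(* U^-_F, as a subset of the type of members of F. *)
Definition hit (U : set X) : set F := [set Y | (val Y `&` U) !=set0].

Definition hitK (K : set (set X)) : set (set F) := [set hit U | U in K].

End Hit.
Arguments hit {X} F U.
Arguments hitK {X} F K.

Section MonotoneSemilattices.
Variables (d : Order.disp_t) (A : tMeetSemilatticeType d) (m : A -> A).
Local Notation X := (irrFilter A).
Local Notation K := (@KA d A).

Definition idealOf (Z : set X) : set A := [set a | beta a `&` Z = set0].

Definition Rm : set (X * set X) := [set PZ |
  ZK K PZ.2 /\ (m @^-1` val PZ.1) `&` idealOf PZ.2 = set0].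

Definition Rm_image (Y : set X) : set (set X) :=
  [set Z | exists2 y, Y y & Rm (y, Z)].

Definition hit_upset (F H : set (set X)) : set (set X) :=
  [set V | K V /\ exists2 U, (H `&` K) U & hit F U `<=` hit F V].

Definition hit_increasing (F H : set (set X)) := hit_upset F H = H `&` K.

Record monotone_lower_Vietoris (F : set (set X)) : Prop := {
  mlV_closed : F `<=` closedK K ;
  mlV_nonempty : forall Y, F Y -> Y !=set0 ;
  mlV_S_space : S_space (hitK F K) ;
  mlV_increasing : forall Y, F Y -> hit_increasing F (Rm_image Y)
}.

Record is_congruence (theta : set (A * A)) : Prop := {
  cong_refl : forall a, theta (a, a) ;
  cong_sym : forall a b, theta (a, b) -> theta (b, a) ;
  cong_trans : forall a b c, theta (a, b) -> theta (b, c) -> theta (a, c) ;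
  cong_meet : forall a b a' b', theta (a, a') -> theta (b, b') ->
    theta ((a `&` b)%O, (a' `&` b')%O) ;
  cong_m : forall a b, theta (a, b) -> theta (m a, m b)
}.

Definition theta_of (F : set (set X)) : set (A * A) :=
  [set ab | hit F (~` beta ab.1) = hit F (~` beta ab.2)].

End MonotoneSemilattices.

Section Quotient.
Local Open Scope quotient_scope.
Variables (d : Order.disp_t) (A : tMeetSemilatticeType d) (m : A -> A).
Variables (theta : set (A * A)) (h : is_congruence m theta).

Definition cong_rel : rel A := fun a b => `[< theta (a, b) >].

Lemma cong_rel_refl : reflexive cong_rel.
Proof. by move=> a; apply/asboolP/(cong_refl h). Qed.

Lemma cong_rel_sym : symmetric cong_rel.
Proof. by move=> a b; apply/asboolP/asboolP; apply: (cong_sym h). Qed.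

Lemma cong_rel_trans : transitive cong_rel.
Proof.
move=> b a c /asboolP hab /asboolP hbc.
by apply/asboolP; apply: (cong_trans h) hab hbc.
Qed.

Definition cong_equiv : equiv_rel A :=
  EquivRel cong_rel cong_rel_refl cong_rel_sym cong_rel_trans.

Definition quot : Type := {eq_quot cong_equiv}.
HB.instance Definition _ := Choice.on quot.
HB.instance Definition _ := EqQuotient.on quot.

Definition qmap (a : A) : quot := \pi_quot a.

Lemma qmapP a b : qmap a = qmap b <-> theta (a, b).
Proof.
by split=> [/eqmodP /asboolP //|hab]; apply/eqmodP/asboolP.
Qed.

Lemma qmapK (x : quot) : qmap (repr x) = x.
Proof. exact: reprK. Qed.

Definition quot_meet (x y : quot) : quot := qmap (repr x `&` repr y)%O.

Lemma qmapI a b : qmap (a `&` b)%O = quot_meet (qmap a) (qmap b).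
Proof.
by apply/qmapP/(cong_meet h); apply/qmapP; rewrite qmapK.
Qed.

Definition quot_le : rel quot := fun x y => quot_meet x y == x.

Lemma quot_meetC : commutative quot_meet.
Proof. by move=> x y; rewrite /quot_meet meetC. Qed.

Lemma quot_meetA : associative quot_meet.
Proof.
by move=> x y z; rewrite -[x]qmapK -[y]qmapK -[z]qmapK -!qmapI meetA.
Qed.

Lemma quot_le_refl : reflexive quot_le.
Proof. by move=> x; apply/eqP; rewrite -[x]qmapK -qmapI meetxx. Qed.

Lemma quot_le_anti : antisymmetric quot_le.
Proof. by move=> x y /andP[/eqP xy /eqP yx]; rewrite -xy quot_meetC yx. Qed.

Lemma quot_le_trans : transitive quot_le.
Proof.
move=> y x z /eqP xy /eqP yz; apply/eqP.
by rewrite -{1}xy -quot_meetA yz.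
Qed.

HB.instance Definition _ := Order.Le_isPOrder.Build d quot
  quot_le_refl quot_le_anti quot_le_trans.

Lemma quot_leEmeet (x y : quot) : (x <= y)%O = (quot_meet x y == x).
Proof. by []. Qed.

HB.instance Definition _ := Order.POrder_Meet_isSemilattice.Build d quot
  quot_meetC quot_meetA quot_leEmeet.

Lemma quot_lex1 (x : quot) : (x <= qmap \top)%O.
Proof. by rewrite quot_leEmeet -[x]qmapK -qmapI meetx1. Qed.

HB.instance Definition _ := Order.hasTop.Build d quot quot_lex1.

Definition Rq : set (irrFilter quot * irrFilter A) :=
  [set QP | (qmap @^-1` val QP.1) `<=` val QP.2].

Definition F_Rq : set (set (irrFilter A)) :=
  [set [set P | Rq (Q, P)] | Q in setT].

End Quotient.

(* Main.v *)
(* A closed set Y of irreducible filters is determined by the filter G_Y of all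
   a with Y included in beta(a), and (a, b) is in theta_F iff a and b belong to
   the same G_Y, Y in F. Hence each G_Y, Y in F, is the preimage of a filter of
   A / theta_F, and (1) amounts to saying that these filters are exactly the
   irreducible ones: (S3) makes each of them irreducible, while (S4) together
   with compactness of the subbasic sets produces a Y for every irreducible Q.
   Monotonicity of m gives beta(a)^c in R_m[Y] iff m a is not in G_Y, so that
   the increasing condition is compatibility of theta_F with m. Part (2) is the
   separation of points from filters by irreducible filters, in A and in
   A / theta. *)

Require Import Defs.
From HB Require Import structures.
From mathcomp Require Import all_boot all_order.
From mathcomp Require Import boolp classical_sets topology.

Set Implicit Arguments.
Unset Strict Implicit.
Unset Printing Implicit Defensive.

Import Order.TTheory.
Local Open Scope classical_set_scope.

(** * Irreducible filters and separation *)

Section FilterSeparation.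
Variables (d : Order.disp_t) (B : tMeetSemilatticeType d).
Implicit Types (G H P : set B) (a b c f : B).

Lemma irrFilter_irreducible (P : irrFilter B) : irreducible_filter (val P).
Proof. exact: set_mem (valP P). Qed.

Lemma irrFilter_filter (P : irrFilter B) : sl_filter (val P).
Proof. by case: (irrFilter_irreducible P). Qed.

Lemma sl_filter_principal a : sl_filter [set b | (a <= b)%O].
Proof.
split=> [|b c|b c] /=; first exact: lex1.
- by move=> bc ab; exact: le_trans bc.
- by rewrite lexI => -> ->.
Qed.

Lemma sl_filter_adjoin G a : sl_filter G ->
  sl_filter [set c | exists2 f, G f & (a `&` f <= c)%O].
Proof.
case=> G1 Gle GI; split=> [|b c bc|b c]; first by exists \top%O; rewrite ?lex1.
- by case=> f Gf afb; exists f => //; exact: le_trans bc.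
case=> f Gf afb [f' Gf' afc]; exists (f `&` f')%O; first exact: GI.
by rewrite lexI (le_trans _ afb) ?(le_trans _ afc) // leI2 ?leIl ?leIr.
Qed.

(** If no such [f] and [c] exist, [G] is the intersection of the filters generated by [G] with [a]
    and by [G] with [b]. Conversely, if [G] were the intersection of [H1] and [H2], with [a] in [H1]
    and [b] in [H2] both outside [G], then [c] would lie in [H1] and [H2], hence in [G]. *)
Lemma irreducible_filterP G : sl_filter G -> G <> setT ->
  irreducible_filter G <-> forall a b, ~ G a -> ~ G b ->
    exists f c, [/\ G f, ~ G c, (a `&` f <= c)%O & (b `&` f <= c)%O].
Proof.
move=> fG pG; have [G1 Gle GI] := fG; split=> [[_ _ irrG] a b Ga Gb|sepG].
  apply: contrapT => nsep; apply: irrG.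
  exists [set c | exists2 f, G f & (a `&` f <= c)%O].
  exists [set c | exists2 f, G f & (b `&` f <= c)%O].
  split; try exact: sl_filter_adjoin.
  - by move=> GE; apply: Ga; rewrite -GE; exists \top%O; rewrite ?leIl.
  - by move=> GE; apply: Gb; rewrite -GE; exists \top%O; rewrite ?leIl.
  apply/seteqP; split=> [c Gc|c [[f Gf afc] [f' Gf' bfc]]].
    by split; exists c; rewrite ?leIr.
  apply: contrapT => Gc; apply: nsep; exists (f `&` f')%O, c; split=> //.
  - exact: GI.
  - by rewrite (le_trans _ afc) // leI2 ?leIl.
  - by rewrite (le_trans _ bfc) // leI2 ?leIr.
split=> // -[H1] [H2] [[_ H1le H1I] [_ H2le H2I] H1G H2G GE].
have [a H1a Ga] : exists2 a, H1 a & ~ G a.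
  apply: contrapT => noa; apply: H1G; apply/seteqP; split=> [a H1a|a].
    by apply: contrapT => Ga; apply: noa; exists a.
  by rewrite GE => -[].
have [b H2b Gb] : exists2 b, H2 b & ~ G b.
  apply: contrapT => nob; apply: H2G; apply/seteqP; split=> [b H2b|b].
    by apply: contrapT => Gb; apply: nob; exists b.
  by rewrite GE => -[].
have [f [c [Gf Gc afc bfc]]] := sepG _ _ Ga Gb.
apply: Gc; move: Gf; rewrite GE => -[H1f H2f]; split.
- by apply: H1le afc _; exact: H1I.
- by apply: H2le bfc _; exact: H2I.
Qed.

(** A filter above [G] maximal among those avoiding [a] is irreducible: all strictly larger filters
    contain [a], so two of them cannot intersect in it. *)
Lemma irreducible_separation G a : sl_filter G -> ~ G a ->
  exists2 P : irrFilter B, G `<=` val P & ~ val P a.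
Proof.
move=> fG Ga; have [G1 Gle GI] := fG.
(* Joining [G] to [H] makes the empty union, coming from the empty chain, satisfy [good]. *)
pose good H := sl_filter (G `|` H) /\ ~ (G `|` H) a.
have [C Cgood Ctot|H [[fP Pa] Hmax]] := @Zorn_bigcup _ good.
  split; last by case=> // -[H CH Ha]; have [_] := Cgood _ CH; apply; right.
  split; first by left.
    move=> x y xy [Gx|[H CH Hx]]; first by left; exact: Gle xy Gx.
    have [[_ Hle _] _] := Cgood _ CH.
    by have [|Gy|Hy] := Hle _ _ xy; [right|left|right; exists H].
  have CI H x y : C H -> (G `|` H) x -> (G `|` H) y ->
      (G `|` \bigcup_(X in C) X) (x `&` y)%O.
    move=> CH Hx Hy; have [[_ _ HI] _] := Cgood _ CH.
    by have [Gxy|Hxy] := HI _ _ Hx Hy; [left|right; exists H].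
  move=> x y [Gx|[H CH Hx]] [Gy|[H' CH' H'y]].
  - by left; exact: GI.
  - by apply: CI CH' _ _; [left|right].
  - by apply: CI CH _ _; [right|left].
  have [HH'|H'H] := Ctot _ _ CH CH'.
  - by apply: CI CH' _ _; right => //; exact: HH'.
  - by apply: CI CH _ _; right => //; exact: H'H.
set P := G `|` H in fP Pa.
have maxP G' : sl_filter G' -> P `<=` G' -> G' <> P -> G' a.
  move=> fG' PG' G'P; apply: contrapT => G'a; apply: (Hmax G').
    split=> [x Hx|G'H]; first by apply: PG'; right.
    by apply: G'P; apply/seteqP; split=> // x /G'H; right.
  by rewrite /good setUidr // => x Gx; apply: PG'; left.
have irrP : irreducible_filter P.
  split=> //; first by move=> PT; apply: Pa; rewrite PT.
  move=> [H1] [H2] [fH1 fH2 H1P H2P PE]; apply: Pa; rewrite PE; split.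
  - by apply: maxP => //; rewrite PE; exact: subIsetl.
  - by apply: maxP => //; rewrite PE; exact: subIsetr.
by exists (SigSub (mem_set irrP)) => // x Gx; left.
Qed.

Lemma le_beta a b : (a <= b)%O <-> beta a `<=` beta b.
Proof.
split=> [ab P|ab]; first by have [_ Ple _] := irrFilter_filter P; exact: Ple.
apply: contrapT => nab.
have [P aP] := irreducible_separation (sl_filter_principal a) nab.
by apply; apply: ab; apply: aP => /=.
Qed.

End FilterSeparation.

(** * Closed sets and their filters *)

Section ClosedSets.
Variables (d : Order.disp_t) (A : tMeetSemilatticeType d).
Local Notation X := (irrFilter A).
Local Notation K := (@KA d A).
Implicit Types (Y : set X) (F : set (set X)) (a b : A).

Definition filterOf Y : set A := [set a | Y `<=` beta a].

Lemma filterOf_filter Y : sl_filter (filterOf Y).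
Proof.
split=> [P _|a b /le_beta ab Ya|a b Ya Yb P YP].
- by have [] := irrFilter_filter P.
- exact: subset_trans ab.
- by have [_ _ PI] := irrFilter_filter P; apply: PI; [exact: Ya|exact: Yb].
Qed.

Lemma filterOf_proper Y : Y !=set0 -> filterOf Y <> setT.
Proof.
case=> P YP YT; have [_ PT _] := irrFilter_irreducible P; apply: PT.
by apply/seteqP; split=> // a _; have : filterOf Y a by [rewrite YT]; exact.
Qed.

(** Each set in a family with intersection [Y] is a [beta a] containing [Y], so its [a] lies in
    [filterOf Y]. *)
Lemma closedK_filterOf Y : closedK K Y -> Y = [set P | filterOf Y `<=` val P].
Proof.
move=> [J JK YE]; apply/seteqP; split=> [P YP a|P /= GP]; first exact.
rewrite YE => V JV; have [_ [a _ <-] VE] := JK _ JV.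
rewrite setCK in VE; rewrite -VE; apply: GP; rewrite /filterOf /= YE VE.
exact: bigcap_inf.
Qed.

Lemma filterOf_upper G : sl_filter G ->
  filterOf [set P : X | G `<=` val P] = G.
Proof.
move=> fG; apply/seteqP; split=> [a Ga|a Ga P]; last exact.
apply: contrapT => /(irreducible_separation fG)[P GP]; apply; exact: Ga.
Qed.

Lemma hit_setC_beta F a (Y : F) :
  hit F (~` beta a) Y <-> ~ filterOf (val Y) a.
Proof.
split=> [[P [YP Pa]] /(_ _ YP)//|Ya]; apply: contrapT => nY; apply: Ya => P YP.
by apply: contrapT => Pa; apply: nY; exists P.
Qed.

Lemma sub_hitP F a b : hit F (~` beta b) `<=` hit F (~` beta a) <->
  forall Y, F Y -> filterOf Y a -> filterOf Y b.
Proof.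
split=> [ab Y FY Ya|ab Y /hit_setC_beta Yb].
  apply: contrapT => Yb.
  have /ab/hit_setC_beta : hit F (~` beta b) (SigSub (mem_set FY)).
    exact/hit_setC_beta.
  exact.
by apply/hit_setC_beta => /(ab _ (set_mem (valP Y))).
Qed.

Lemma theta_ofP F a b : theta_of F (a, b) <->
  forall Y, F Y -> filterOf Y a <-> filterOf Y b.
Proof.
rewrite /theta_of /=; split=> [/seteqP[ab ba] Y FY|ab].
  by split; [exact: (sub_hitP F a b).1|exact: (sub_hitP F b a).1].
by apply/seteqP; split; apply/sub_hitP => Y FY /(ab _ FY).
Qed.

End ClosedSets.

(** * From a Vietoris family to a congruence and back *)

Section VietorisFamily.
Variables (d : Order.disp_t) (A : tMeetSemilatticeType d) (m : A -> A).
Hypothesis m_mono : forall a b : A, (a <= b)%O -> (m a <= m b)%O.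
Local Notation X := (irrFilter A).
Local Notation K := (@KA d A).

Lemma ZK_setC_beta (a : A) : ZK K (~` beta a).
Proof.
exists [set ~` beta a]; split=> [_ ->||]; first by exists a.
- split; first by exists (~` beta a).
  by move=> _ _ -> ->; exists (~` beta a) => //; rewrite setIid.
- by rewrite bigcap_set1.
Qed.

(* Since [beta c `<=` beta a] implies [c <= a], the element
   [m a] is the largest value of [m] on the ideal of [~` beta a]. *)
Lemma Rm_image_setC_beta (Y : set X) (a : A) :
  Rm_image m Y (~` beta a) <-> ~ filterOf Y (m a).
Proof.
split=> [[P YP [_ /= /seteqP[mP _]]] Yma|Yma].
  by apply: (mP a); split=> /=; [exact: Yma|rewrite /idealOf /= setICr].
apply: contrapT => nR; apply: Yma => P YP; apply: contrapT => Pma; apply: nR.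
exists P => //; split=> /=; first exact: ZK_setC_beta.
apply/seteqP; split=> // c [/= Pmc].
rewrite /idealOf /= => /disjoints_subset; rewrite setCK => /le_beta ca.
by apply: Pma; have [_ Ple _] := irrFilter_filter P; exact: Ple (m_mono ca) Pmc.
Qed.

Variable F : set (set X).
Hypothesis mlVF : monotone_lower_Vietoris m F.

Lemma theta_of_congruence : is_congruence m (theta_of F).
Proof.
split=> [a|a b|a b c|a b a' b'|a b].
- by apply/theta_ofP.
- by move=> /theta_ofP ab; apply/theta_ofP => Y FY; apply: iff_sym; exact: ab.
- move=> /theta_ofP ab /theta_ofP bc; apply/theta_ofP => Y FY.
  by apply: iff_trans (ab _ FY) (bc _ FY).
- move=> /theta_ofP aa' /theta_ofP bb'; apply/theta_ofP => Y FY.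
  have [_ Yle YI] := filterOf_filter Y.
  split=> Yab; apply: YI.
  + by apply/(aa' _ FY); exact: Yle (leIl _ _) Yab.
  + by apply/(bb' _ FY); exact: Yle (leIr _ _) Yab.
  + by apply/(aa' _ FY); exact: Yle (leIl _ _) Yab.
  + by apply/(bb' _ FY); exact: Yle (leIr _ _) Yab.
suff sub (x y : A) Y : theta_of F (x, y) -> F Y ->
    filterOf Y (m x) -> filterOf Y (m y).
  move=> ab; apply/theta_ofP => Y FY; split; first exact: sub.
  by apply: sub => //; rewrite /theta_of /= ab.
(* If [m y] is missing from [filterOf Y], then [~] beta y[is in the image of]Y[; as]x[and]y[have
   equal hit sets, the increasing condition puts]~[beta x] there too, against [Ymx]. *)
rewrite /theta_of /= => xy FY Ymx; apply: contrapT => /Rm_image_setC_beta Ry.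
have /Rm_image_setC_beta : Rm_image m Y (~` beta x); last exact.
suff : hit_upset F (Rm_image m Y) (~` beta x).
  by rewrite (mlV_increasing mlVF FY) => -[].
split; first by exists x.
by exists (~` beta y); [split=> //; exists y|rewrite xy].
Qed.

Let theta_cong := theta_of_congruence.
Local Notation q := (@qmap d A m (theta_of F) theta_cong).

Lemma hitK_setC_beta (a : A) : hitK F K (hit F (~` beta a)).
Proof. by exists (~` beta a) => //; exists a. Qed.

(** By [sub_hitP], the quotient order is reverse inclusion of hit sets; this translates (S3) and
    (S4) into inequalities. *)
Lemma qmap_leP (a b : A) :
  (q a <= q b)%O <-> forall Y, F Y -> filterOf Y a -> filterOf Y b.
Proof.
rewrite quot_leEmeet -qmapI; split=> [/eqP/qmapP/theta_ofP ab Y FY Ya|ab].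
  have [_ Yle _] := filterOf_filter Y.
  by apply: Yle (leIr b a) _; apply/ab.
apply/eqP/qmapP/theta_ofP => Y FY; have [_ Yle YI] := filterOf_filter Y.
split=> [|Ya]; first exact: Yle (leIl _ _).
by apply: YI => //; exact: ab.
Qed.

Definition quotFilterOf (Y : set X) : set (quot theta_cong) :=
  q @` filterOf Y.

Lemma preimage_quotFilterOf Y : F Y -> q @^-1` quotFilterOf Y = filterOf Y.
Proof.
move=> FY; apply/seteqP; split=> [a [b Yb] /qmapP/theta_ofP ba|a Ya].
  exact/ba.
by exists a.
Qed.

Lemma quotFilterOfE Y a : F Y -> quotFilterOf Y (q a) <-> filterOf Y a.
Proof. by move=> FY; rewrite -[in X in _ <-> X](preimage_quotFilterOf FY). Qed.

(** (S3) at the point [Y] is the criterion [irreducible_filterP]: the set [W] avoiding [Y] supplies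
    the element inside the filter, and the set [D] containing [Y] the element outside. *)
Lemma quotFilterOf_irreducible Y : F Y -> irreducible_filter (quotFilterOf Y).
Proof.
move=> FY; have [Y1 Yle YI] := filterOf_filter Y.
have fQ : sl_filter (quotFilterOf Y).
  split=> [|x y|x y]; first by exists \top%O.
  - rewrite -[x]qmapK -[y]qmapK => /qmap_leP xy /(quotFilterOfE _ FY) Yx.
    by apply/quotFilterOfE => //; exact: xy.
  - move=> [a Ya <-] [b Yb <-]; exists (a `&` b)%O; first exact: YI.
    exact: qmapI.
have pQ : quotFilterOf Y <> setT.
  move=> QT; apply: (filterOf_proper (mlV_nonempty mlVF FY)).
  by rewrite -(preimage_quotFilterOf FY) QT.
apply/irreducible_filterP => // x y.
rewrite -[x]qmapK -[y]qmapK; move: (repr x) (repr y) => a b.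
move=> /(quotFilterOfE _ FY) Ya /(quotFilterOfE _ FY) Yb.
pose sY : F := SigSub (mem_set FY).
have [|W [D [[_ [w _ <-] <-] [_ [c _ <-] <-] Yw Yc Dsub]]] :=
    @S3 _ _ (mlV_S_space mlVF) _ _ sY (hitK_setC_beta a) (hitK_setC_beta b).
  by split; exact/hit_setC_beta.
have {}Yw : filterOf Y w.
  by apply: contrapT => Yw'; apply: Yw; exact/hit_setC_beta.
have {}Yc : ~ filterOf Y c by move: Yc => /hit_setC_beta.
have wle e : hit F (~` beta c) `<=` hit F (~` beta e) `|` hit F (~` beta w) ->
    (q e `&` q w <= q c)%O.
  move=> He; rewrite -[(_ `&` _)%O]qmapI; apply/qmap_leP => Z FZ Zew.
  have [_ Zle _] := filterOf_filter Z; apply: contrapT => Zc.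
  have [|/hit_setC_beta|/hit_setC_beta] := He (SigSub (mem_set FZ)).
  - exact/hit_setC_beta.
  - by apply; exact: Zle (leIl _ _) Zew.
  - by apply; exact: Zle (leIr _ _) Zew.
exists (q w), (q c); split.
- exact/quotFilterOfE.
- by move=> /(quotFilterOfE _ FY).
- by apply: wle => Z /Dsub [[]|]; [left|right].
- by apply: wle => Z /Dsub [[]|]; [left|right].
Qed.

Lemma qmap_preimage_filter (Q : set (quot theta_cong)) :
  sl_filter Q -> sl_filter (q @^-1` Q).
Proof.
case=> Q1 Qle QI; split=> [|a b ab|a b Qa Qb] //=.
- apply: Qle; apply/qmap_leP => Y FY; have [_ Yle _] := filterOf_filter Y.
  exact: Yle.
- by rewrite qmapI; exact: QI.
Qed.

(* [Y] is a cluster point of the filter base formed by the sets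
   [{Z in hit F (~` beta a) | g in filterOf Z}], [g] in [q^-1 Q]. *)
Lemma compact_separation (Q : set (quot theta_cong)) (a : A) :
  sl_filter Q -> ~ Q (q a) ->
  exists2 Y, F Y & q @^-1` Q `<=` filterOf Y /\ ~ filterOf Y a.
Proof.
move=> fQ Qa; have [G1 Gle GI] := qmap_preimage_filter fQ.
pose base (g : A) : set (subbase_space (hitK F K)) :=
  [set Y | hit F (~` beta a) Y /\ filterOf (val Y) g].
pose Phi := filter_from (q @^-1` Q) base.
have PhiF : ProperFilter Phi.
  apply: filter_from_proper.
    apply: filter_from_filter; first by exists \top%O.
    move=> g h Qg Qh; exists (g `&` h)%O; first exact: GI.
    move=> Y [Ya Ygh]; have [_ Yle _] := filterOf_filter (val Y).
    by split; split=> //; [exact: Yle (leIl _ _) Ygh|exact: Yle (leIr _ _) Ygh].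
  (* An empty [base g] would give [q g <= q a], and so put [q a] in [Q]. *)
  move=> g Qg; apply: contrapT => nY; apply: Qa.
  have [_ Qle _] := fQ; apply: Qle Qg; apply/qmap_leP => Y FY Yg.
  apply: contrapT => Ya; apply: nY; exists (SigSub (mem_set FY)).
  by split=> //; exact/hit_setC_beta.
have [_ cpt] := S2_compact_open (mlV_S_space mlVF) (hitK_setC_beta a).
have [|Y [Ya clY]] := cpt Phi PhiF; first by exists \top%O => // Y [].
exists (val Y); first exact: set_mem (valP Y).
split; last by move: Ya => /hit_setC_beta.
move=> g Qg; apply: contrapT => Yg.
have [opg _] := S2_compact_open (mlV_S_space mlVF) (hitK_setC_beta g).
(* If [g] were not in [filterOf Y], this hit set would be a neighbourhood of [Y] disjoint from
   [base g]. *)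
have [||Z [[_ Zg] /hit_setC_beta]] := clY (base g) (hit F (~` beta g)).
- by exists g.
- by apply: open_nbhs_nbhs; split=> //; exact/hit_setC_beta.
- exact.
Qed.

Lemma irreducible_preimage_filterOf (Q : irrFilter (quot theta_cong)) :
  exists2 Y, F Y & filterOf Y = q @^-1` val Q.
Proof.
have irrQ := irrFilter_irreducible Q; have [fQ pQ _] := irrQ.
have [G1 Gle GI] := qmap_preimage_filter fQ.
pose D (a : A) : set F := ~` hit F (~` beta a).
have DE a Y : D a Y <-> filterOf (val Y) a.
  rewrite /D /setC /=; split=> [nY|Ya /hit_setC_beta //].
  by apply: contrapT => Ya; apply: nY; exact/hit_setC_beta.
have coD a : coK (hitK F K) (D a).
  by exists (hit F (~` beta a)) => //; exact: hitK_setC_beta.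
(* Lying in [YY] means that the filter contains the preimage of [Q]; avoiding every set of [J] means
   that it contains nothing else. (S4) provides a point doing both. *)
pose YY := \bigcap_(V in D @` (q @^-1` val Q)) V.
pose J := D @` (~` (q @^-1` val Q)).
have [|||||Y [YQ YJ]] := @S4 _ _ (mlV_S_space mlVF) YY J.
- by exists (D @` (q @^-1` val Q)) => // _ [a _ <-].
- by move=> _ [a _ <-].
- apply: contrapT => nJ; apply: pQ; apply/seteqP; split=> // x _.
  rewrite -[x]qmapK; apply: contrapT => Qx; apply: nJ.
  by exists (D (repr x)), (repr x).
(* Irreducibility of [Q] makes [J] a [YY]-family: [D f] contains [YY] because [q f] is in [Q], and
   [D c] is in [J] because [q c] is not. *)
- move=> _ _ [a Qa <-] [b Qb <-].
  have [f [c [Qf Qc]]] := (irreducible_filterP fQ pQ).1 irrQ _ _ Qa Qb.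
  rewrite -[f]qmapK -[c]qmapK in Qf Qc *; move: (repr f) (repr c) Qf Qc.
  move=> {}f {}c Qf Qc.
  have le e : (q e `&` q f <= q c)%O -> D e `&` D f `<=` D c.
    rewrite -[(_ `&` _)%O]qmapI => /qmap_leP efc Y [/DE Ye /DE Yf]; apply/DE.
    have [_ _ YI] := filterOf_filter (val Y).
    by apply: efc (set_mem (valP Y)) _; exact: YI.
  move=> afc bfc; exists (D f), (D c); split=> //; try exact: le.
  + by exists c.
  + by move=> Y; apply; exists f.
- move=> _ [a Qa <-]; have [Y FY [QY Ya]] := compact_separation fQ Qa.
  exists (SigSub (mem_set FY)); split=> [_ [g Qg <-]|]; first exact/DE/QY.
  by move=> /DE.
exists (val Y); first exact: set_mem (valP Y).
apply/seteqP; split=> a.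
  move=> Ya; apply: contrapT => Qa; apply: (YJ (D a)); first by exists a.
  exact/DE.
by move=> Qa; apply/DE; apply: YQ; exists a.
Qed.

(** A closed [Y] is the set of [P] above [filterOf Y], and the image of [Q] under [Rq] the set of
    [P] above the preimage of [Q], so it suffices to match these filters. *)
Lemma mlV_F_Rq : F = F_Rq theta_cong.
Proof.
apply/seteqP; split=> [Y FY|_ [Q _ <-]].
  exists (SigSub (mem_set (quotFilterOf_irreducible FY))) => //.
  rewrite [RHS](closedK_filterOf (mlV_closed mlVF FY)).
  by rewrite -(preimage_quotFilterOf FY).
have [Y FY YQ] := irreducible_preimage_filterOf Q.
suff -> : [set P | Rq (Q, P)] = Y by [].
by rewrite [RHS](closedK_filterOf (mlV_closed mlVF FY)) YQ.
Qed.

End VietorisFamily.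

(** Separation in [A] gives [YQ], so both relations compare membership of the classes of [a] and [b]
    in irreducible filters of the quotient; separation there, as [le_beta], makes the classes
    equal. *)
Lemma theta_of_F_Rq (d : Order.disp_t) (A : tMeetSemilatticeType d) (m : A -> A)
    (theta : set (A * A)) (h : is_congruence m theta) :
  theta = theta_of (F_Rq h).
Proof.
have YQ (Q : irrFilter (quot h)) :
    filterOf [set P | Rq (Q, P)] = qmap h @^-1` val Q.
  apply: filterOf_upper; have [Q1 Qle QI] := irrFilter_filter Q.
  split=> [|a b /meet_l ab|a b Qa Qb] //=.
    by apply: Qle; rewrite quot_leEmeet -qmapI ab.
  by rewrite qmapI; exact: QI.
apply/seteqP; split=> -[a b].
  move=> ab; apply/theta_ofP => _ [Q _ <-]; rewrite YQ /=.
  by rewrite ((qmapP h a b).2 ab).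
move=> /theta_ofP ab; apply/(qmapP h)/le_anti/andP; split; apply/le_beta => Q.
- by have := (ab _ (imageT _ Q)).1; rewrite YQ.
- by have := (ab _ (imageT _ Q)).2; rewrite YQ.
Qed.

Theorem theorem21 (d : Order.disp_t) (A : tMeetSemilatticeType d) (m : A -> A)
    (m_mono : forall a b : A, (a <= b)%O -> (m a <= m b)%O) :
  (forall F : set (set (irrFilter A)), monotone_lower_Vietoris m F ->
    exists h : is_congruence m (theta_of F), F = F_Rq h) /\
  (forall (theta : set (A * A)) (h : is_congruence m theta),
    theta = theta_of (F_Rq h)).
Proof.
split=> [F mlVF|theta h]; last exact: theta_of_F_Rq.
by exists (theta_of_congruence m_mono mlVF); exact: mlV_F_Rq.
Qed.
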